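(* Let $\alpha>0$, $U_0>0$, $k>0$ be real, let $U$ be the parabolic barrier $U(x)=\frac{U_0}{\alpha^2}(\alpha^2-x^2)$ for $|x|\le\alpha$ and $U(x)=0$ for $|x|\ge\alpha$, and let $\psi_e,\psi_o$ be the even and odd solutions on $[-\alpha,\alpha]$ of $\psi''+[k^2-2U(x)]\psi=0$ given in the context. Define $$L_e:=\alpha\frac{\psi_e'(\alpha)}{\psi_e(\alpha)},\qquad L_o:=\alpha\frac{\psi_o'(\alpha)}{\psi_o(\alpha)}.$$ A solution of $\psi''+[k^2-2U(x)]\psi=0$ on $\mathbb{R}$ representing an incoming wave from the left, partially reflected and partially transmitted by the barrier, has the form $$\psi(x)=\begin{cases}e^{ikx}+r\,e^{-ikx}, & x\le-\alpha,\\ A\,\psi_e(x)+B\,\psi_o(x), & -\alpha\le x\le\alpha,\\ t\,e^{ikx}, & x\ge\alpha,\end{cases}$$ with constants $r,A,B,t$. Requiring $\psi$ to be continuously differentiable at $x=-\alpha$ and $x=\alpha$ gives $$r=-\frac12 e^{-2ik\alpha}\left[\frac{L_e+ik\alpha}{L_e-ik\alpha}+\frac{L_o+ik\alpha}{L_o-ik\alpha}\right],\qquad t=-\frac12 e^{-2ik\alpha}\left[\frac{L_e+ik\alpha}{L_e-ik\alpha}-\frac{L_o+ik\alpha}{L_o-ik\alpha}\right],$$ $$A=\frac{(t+r)e^{ik\alpha}+e^{-ik\alpha}}{2\psi_e(\alpha)},\qquad B=\frac{(t-r)e^{ik\alpha}-e^{-ik\alpha}}{2\psi_o(\alpha)}.$$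 Moreover the reflection coefficient $R=|r|^2$ and transmission coefficient $T=|t|^2$ are $$R=\frac{(L_eL_o+k^2\alpha^2)^2}{(L_e^2+k^2\alpha^2)(L_o^2+k^2\alpha^2)},\qquad T=\frac{k^2\alpha^2(L_e-L_o)^2}{(L_e^2+k^2\alpha^2)(L_o^2+k^2\alpha^2)},$$ and $R+T=1$.
   Context: With $\beta=\sqrt{2U_0}/\alpha$, the solutions are $$\psi_e(x)=e^{-\frac{i\beta}{2}x^2}M\!\left[\tfrac14\left(1+\tfrac{ik^2}{\beta}-i\alpha^2\beta\right),\tfrac12,i\beta x^2\right],\quad \psi_o(x)=x\sqrt{2\beta}\,e^{-\frac{i\beta}{2}x^2}M\!\left[\tfrac14\left(3+\tfrac{ik^2}{\beta}-i\alpha^2\beta\right),\tfrac32,i\beta x^2\right],$$ where $M[a,b,z]=\sum_{n\ge 0}\frac{(a)_n}{(b)_n}\frac{z^n}{n!}$ is the Kummer confluent hypergeometric function. On real arguments $\psi_e$ and $\psi_o$ are real valued, $\psi_e$ is even and $\psi_o$ is odd, and $\psi_e(0)=1$, $\psi_e'(0)=0$, $\psi_o(0)=0$, $\psi_o'(0)=\sqrt{2\beta}$. Units are $\hbar=m=1$; the incident particle has kinetic energy $k^2/2$. *)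

(* Defs.v *)
From Stdlib Require Import Reals Factorial.
From Coquelicot Require Import Coquelicot.

Open Scope R_scope.

Definition Cexp (z : C) : C :=
  (exp (Re z) * cos (Im z), exp (Re z) * sin (Im z)).

(* Rising factorial (a)_n = a (a+1) ... (a+n-1). *)
Fixpoint Cpoch (a : C) (n : nat) : C :=
  match n with
  | O => RtoC 1
  | S m => (Cpoch a m * (a + RtoC (INR m)))%C
  end.

(* Coquelicot's [Series] is real valued: sum real and imaginary parts. *)
Definition CSeries (u : nat -> C) : C :=
  (Series (fun n => Re (u n)), Series (fun n => Im (u n))).

Definition Kummer (a b z : C) : C :=
  CSeries (fun n => Cpoch a n / Cpoch b n * (z ^ n / RtoC (INR (fact n))))%C.

(* Functions of a real variable with values in the real normed space C.
   Coquelicot's [C_derive] is the derivative in a complex variable. *)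
Definition is_derive_RC (f : R -> C) (x : R) (l : C) : Prop :=
  @is_derive R_AbsRing C_R_NormedModule f x l.

Definition ex_derive_RC (f : R -> C) (x : R) : Prop :=
  @ex_derive R_AbsRing C_R_NormedModule f x.

Definition Derive_RC (f : R -> C) (x : R) : C :=
  (Derive (fun y => Re (f y)) x, Derive (fun y => Im (f y)) x).

Definition C1_at (f : R -> C) (x : R) : Prop :=
  locally x (fun y : R => ex_derive_RC f y)
  /\ @continuous R_UniformSpace C_UniformSpace (Derive_RC f) x.

Definition barrier (alpha U0 x : R) : R :=
  if Rle_dec (Rabs x) alpha then U0 / alpha ^ 2 * (alpha ^ 2 - x ^ 2) else 0.

(* psi'' + (k^2 - 2 U) psi = 0 on the whole real line. *)
Definition schrodinger_solution (alpha U0 k : R) (psi : R -> C) : Prop :=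
  exists psi1 psi2 : R -> C,
    forall x : R,
      is_derive_RC psi x (psi1 x) /\
      is_derive_RC psi1 x (psi2 x) /\
      (psi2 x + RtoC (k ^ 2 - 2 * barrier alpha U0 x) * psi x)%C = RtoC 0.

Definition beta (alpha U0 : R) : R := sqrt (2 * U0) / alpha.

Definition psi_e (alpha U0 k x : R) : C :=
  let b := beta alpha U0 in
  (Cexp (- (Ci * RtoC b / RtoC 2) * RtoC (x ^ 2)) *
   Kummer (RtoC (1 / 4) *
             (RtoC 1 + Ci * RtoC (k ^ 2) / RtoC b - Ci * RtoC (alpha ^ 2 * b)))
          (RtoC (1 / 2)) (Ci * RtoC (b * x ^ 2)))%C.

Definition psi_o (alpha U0 k x : R) : C :=
  let b := beta alpha U0 in
  (RtoC (x * sqrt (2 * b)) *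
   Cexp (- (Ci * RtoC b / RtoC 2) * RtoC (x ^ 2)) *
   Kummer (RtoC (1 / 4) *
             (RtoC 3 + Ci * RtoC (k ^ 2) / RtoC b - Ci * RtoC (alpha ^ 2 * b)))
          (RtoC (3 / 2)) (Ci * RtoC (b * x ^ 2)))%C.

Definition L_e (alpha U0 k : R) : C :=
  (RtoC alpha * (Derive_RC (psi_e alpha U0 k) alpha / psi_e alpha U0 k alpha))%C.

Definition L_o (alpha U0 k : R) : C :=
  (RtoC alpha * (Derive_RC (psi_o alpha U0 k) alpha / psi_o alpha U0 k alpha))%C.

(* e^{i k x} *)
Definition plane_wave (k x : R) : C := Cexp (Ci * RtoC (k * x)).

(* The three branches overlap at x = -alpha and x = alpha.  Assigning those
   points to one branch is harmless: wherever the function is continuous, the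
   two adjacent branches agree. *)
Definition scattering_wave (alpha U0 k : R) (r A B t : C) (x : R) : C :=
  if Rle_dec x (- alpha) then
    (plane_wave k x + r * plane_wave (- k) x)%C
  else if Rle_dec x alpha then
    (A * psi_e alpha U0 k x + B * psi_o alpha U0 k x)%C
  else (t * plane_wave k x)%C.

(* Main.v *)
(** By the Kummer equation, psi_e and psi_o solve psi'' + (k^2 - 2U) psi = 0
    with the parabolic potential, with data (1, 0) and (0, sqrt(2 beta)) at 0.
    An energy estimate gives uniqueness for this linear equation.  Hence every
    solution is a combination of psi_e and psi_o inside the barrier, and since
    the equation and the initial data are real, so are psi_e, psi_o, L_e and L_o.
    Continuous differentiability at the two edges is a system of four linear
    equations; by parity, sums and differences decouple it into two 2x2 systems,
    one for (t + r, A) and one for (t - r, B), solvable because L - i k alpha is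
    nonzero for real L.  As (L + i k alpha) / (L - i k alpha) has modulus one,
    R and T follow by taking moduli. *)

Require Import Defs.
From Stdlib Require Import Reals Factorial Lra Psatz.
From Coquelicot Require Import Coquelicot.

Open Scope R_scope.

(** * Calculus of complex-valued functions of a real variable *)

Lemma C_ext (z w : C) : Re z = Re w -> Im z = Im w -> z = w.
Proof. destruct z, w; simpl; intros -> ->; reflexivity. Qed.

(** The projections are linear, hence preserve derivatives. Conversely f = Re f * (1, 0) + Im f *
    (0, 1) is a sum of real functions times fixed vectors. This transfers real calculus to values in
    [C]. *)
Lemma is_derive_RC_pair (f : R -> C) (x : R) (l : C) :
  is_derive_RC f x l <->
  is_derive (fun y => Re (f y)) x (Re l) /\ is_derive (fun y => Im (f y)) x (Im l).
Proof.
  split.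
  - intros H; split.
    + exact (filterdiff_comp' (V := C_R_NormedModule) f fst x _ _ H
               (filterdiff_linear _ is_linear_fst)).
    + exact (filterdiff_comp' (V := C_R_NormedModule) f snd x _ _ H
               (filterdiff_linear _ is_linear_snd)).
  - intros [H1 H2]; unfold is_derive_RC.
    assert (E : forall a b : R, @plus C_R_NormedModule
       (@scal R_AbsRing C_R_NormedModule a ((1, 0) : C))
       (@scal R_AbsRing C_R_NormedModule b ((0, 1) : C)) = (a, b)).
    { intros a b; apply C_ext; cbv; ring. }
    apply is_derive_ext with (fun y => @plus C_R_NormedModule
       (@scal R_AbsRing C_R_NormedModule (Re (f y)) ((1, 0) : C))
       (@scal R_AbsRing C_R_NormedModule (Im (f y)) ((0, 1) : C))).
    { intros t; rewrite E; symmetry; apply surjective_pairing. }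
    replace l with (@plus C_R_NormedModule
       (@scal R_AbsRing C_R_NormedModule (Re l) ((1, 0) : C))
       (@scal R_AbsRing C_R_NormedModule (Im l) ((0, 1) : C)))
      by (rewrite E; symmetry; apply surjective_pairing).
    apply (@is_derive_plus R_AbsRing C_R_NormedModule);
      apply (@is_derive_scal_l R_AbsRing C_R_NormedModule); assumption.
Qed.

Lemma is_derive_RC_eq (f : R -> C) (x : R) (l l' : C) :
  is_derive_RC f x l -> l = l' -> is_derive_RC f x l'.
Proof. now intros H <-. Qed.

Lemma is_derive_RC_ext (f g : R -> C) (x : R) (l : C) :
  (forall y, f y = g y) -> is_derive_RC f x l -> is_derive_RC g x l.
Proof. exact (@is_derive_ext R_AbsRing C_R_NormedModule f g x l). Qed.

Lemma Derive_RC_unique (f : R -> C) (x : R) (l : C) :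
  is_derive_RC f x l -> Derive_RC f x = l.
Proof.
  intros H; apply is_derive_RC_pair in H; destruct H as [H1 H2].
  apply C_ext; simpl; apply is_derive_unique; assumption.
Qed.

Lemma is_derive_RC_const (c : C) (x : R) : is_derive_RC (fun _ => c) x (RtoC 0).
Proof. exact (@is_derive_const R_AbsRing C_R_NormedModule c x). Qed.

Lemma is_derive_RtoC (f : R -> R) (x l : R) :
  is_derive f x l -> is_derive_RC (fun y => RtoC (f y)) x (RtoC l).
Proof.
  intros H; apply is_derive_RC_pair; split; simpl; [exact H|].
  exact (@is_derive_const R_AbsRing R_NormedModule 0 x).
Qed.

Lemma is_derive_RC_plus (f g : R -> C) (x : R) (lf lg : C) :
  is_derive_RC f x lf -> is_derive_RC g x lg ->
  is_derive_RC (fun y => f y + g y)%C x (lf + lg)%C.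
Proof. exact (@is_derive_plus R_AbsRing C_R_NormedModule f g x lf lg). Qed.

Lemma is_derive_RC_mult (f g : R -> C) (x : R) (lf lg : C) :
  is_derive_RC f x lf -> is_derive_RC g x lg ->
  is_derive_RC (fun y => f y * g y)%C x (lf * g x + f x * lg)%C.
Proof.
  rewrite !is_derive_RC_pair; intros [F1 F2] [G1 G2].
  assert (M : forall u v a b, is_derive u x a -> is_derive v x b ->
     is_derive (fun y => u y * v y) x (a * v x + u x * b)).
  { intros u v a b Hu Hv.
    exact (is_derive_mult u v x a b Hu Hv Rmult_comm). }
  split; simpl.
  - eapply is_derive_ext; [intros t; reflexivity|].
    replace (_ + _) with (minus (Re lf * Re (g x) + Re (f x) * Re lg)
                (Im lf * Im (g x) + Im (f x) * Im lg))
      by (unfold minus, plus, opp, Re, Im; simpl; ring).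
    apply (is_derive_minus (V := R_NormedModule)
      (fun y => Re (f y) * Re (g y)) (fun y => Im (f y) * Im (g y)));
    apply M; assumption.
  - replace (_ + _) with (plus (Re lf * Im (g x) + Re (f x) * Im lg)
                (Im lf * Re (g x) + Im (f x) * Re lg))
      by (unfold plus, Re, Im; simpl; ring).
    apply (is_derive_plus (V := R_NormedModule)
      (fun y => Re (f y) * Im (g y)) (fun y => Im (f y) * Re (g y)));
    apply M; assumption.
Qed.

Lemma is_derive_RC_scal (c : C) (f : R -> C) (x : R) (l : C) :
  is_derive_RC f x l -> is_derive_RC (fun y => c * f y)%C x (c * l)%C.
Proof.
  intros H; eapply is_derive_RC_eq.
  - exact (is_derive_RC_mult _ _ _ _ _ (is_derive_RC_const c x) H).
  - cbv beta; ring.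
Qed.

Lemma is_derive_RC_comp (f : R -> C) (g : R -> R) (x : R) (df : C) (dg : R) :
  is_derive_RC f (g x) df -> is_derive g x dg ->
  is_derive_RC (fun y => f (g y)) x (RtoC dg * df)%C.
Proof.
  intros Hf Hg; eapply is_derive_RC_eq.
  - exact (@is_derive_comp R_AbsRing C_R_NormedModule f g x df dg Hf Hg).
  - apply C_ext; cbv; ring.
Qed.

Lemma is_derive_RC_Cexp (f : R -> C) (x : R) (l : C) :
  is_derive_RC f x l -> is_derive_RC (fun y => Cexp (f y)) x (l * Cexp (f x))%C.
Proof.
  rewrite !is_derive_RC_pair; intros [F1 F2]; unfold Cexp, Re at 1, Im at 2; cbn [fst snd].
  set (u := fun y => Re (f y)) in *; set (v := fun y => Im (f y)) in *.
  change (is_derive (fun y => exp (u y) * cos (v y)) x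
            (Re l * (exp (u x) * cos (v x)) - Im l * (exp (u x) * sin (v x))) /\
          is_derive (fun y => exp (u y) * sin (v y)) x
            (Re l * (exp (u x) * sin (v x)) + Im l * (exp (u x) * cos (v x)))).
  assert (ex_derive u x) by (eexists; apply F1).
  assert (ex_derive v x) by (eexists; apply F2).
  assert (Du : Derive (fun y : R => u y) x = Re l) by exact (is_derive_unique u x _ F1).
  assert (Dv : Derive (fun y : R => v y) x = Im l) by exact (is_derive_unique v x _ F2).
  split; auto_derive; auto; rewrite Du, Dv; ring.
Qed.

(** * Everywhere convergent power series with complex coefficients *)

(** The variable stays real and is summed componentwise, so that the theory of [PSeries] (radius,
    termwise derivative) applies to each component. *)
Definition CPSeries (c : nat -> C) (s : R) : C :=
  (PSeries (fun n => Re (c n)) s, PSeries (fun n => Im (c n)) s).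

Definition CPS_derive (c : nat -> C) (n : nat) : C :=
  (RtoC (INR (S n)) * c (S n))%C.

Definition entire (c : nat -> C) : Prop :=
  CV_radius (fun n => Re (c n)) = p_infty /\ CV_radius (fun n => Im (c n)) = p_infty.

Lemma entire_inside (a : nat -> R) (x : R) :
  CV_radius a = p_infty -> Rbar_lt (Rabs x) (CV_radius a).
Proof. now intros ->. Qed.

Lemma Re_CPS_derive (c : nat -> C) (n : nat) :
  Re (CPS_derive c n) = PS_derive (fun m => Re (c m)) n.
Proof. unfold CPS_derive, PS_derive, Re, Im, Cmult, RtoC; cbn [fst snd]; ring. Qed.

Lemma Im_CPS_derive (c : nat -> C) (n : nat) :
  Im (CPS_derive c n) = PS_derive (fun m => Im (c m)) n.
Proof. unfold CPS_derive, PS_derive, Re, Im, Cmult, RtoC; cbn [fst snd]; ring. Qed.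

Lemma entire_derive (c : nat -> C) : entire c -> entire (CPS_derive c).
Proof.
  intros [H1 H2]; split.
  - rewrite (CV_radius_ext _ _ (Re_CPS_derive c)), CV_radius_derive; exact H1.
  - rewrite (CV_radius_ext _ _ (Im_CPS_derive c)), CV_radius_derive; exact H2.
Qed.

Lemma is_derive_CPSeries (c : nat -> C) (s : R) :
  entire c -> is_derive_RC (CPSeries c) s (CPSeries (CPS_derive c) s).
Proof.
  intros [H1 H2]; apply is_derive_RC_pair; split.
  - change (is_derive (PSeries (fun n => Re (c n))) s
              (PSeries (fun n => Re (CPS_derive c n)) s)).
    rewrite (PSeries_ext _ _ s (Re_CPS_derive c)).
    apply is_derive_PSeries, entire_inside, H1.
  - change (is_derive (PSeries (fun n => Im (c n))) s
              (PSeries (fun n => Im (CPS_derive c n)) s)).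
    rewrite (PSeries_ext _ _ s (Im_CPS_derive c)).
    apply is_derive_PSeries, entire_inside, H2.
Qed.

(** For every r >= 0, |a_n| r^n is at most (K r)^n / n!, which tends to 0 and is therefore bounded;
    so the radius is at least r. *)
Lemma CV_radius_factorial_decay (a : nat -> R) (K : R) :
  (forall n, Rabs (a n) <= K ^ n / INR (fact n)) -> CV_radius a = p_infty.
Proof.
  intros H.
  destruct (CV_radius_bounded a) as [U _].
  assert (B : forall r, 0 <= r -> Rbar_le r (CV_radius a)).
  { intros r Hr; apply U.
    destruct (maj_by_pos (fun n => (K * r) ^ n / INR (fact n))) as [M [_ HM]].
    { exists 0; apply cv_speed_pow_fact. }
    exists M; intros n; specialize (HM n); specialize (H n).
    rewrite Rabs_mult, (Rabs_pos_eq (r ^ n)) by (apply pow_le; lra).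
    eapply Rle_trans; [apply Rmult_le_compat_r; [apply pow_le; lra|exact H]|].
    eapply Rle_trans; [|exact HM].
    rewrite Rpow_mult_distr; eapply Rle_trans; [|apply Rle_abs].
    right; unfold Rdiv; ring. }
  pose proof (CV_radius_ge_0 a) as P.
  destruct (CV_radius a) as [r| |]; [|reflexivity|now elim P].
  (* A finite radius [r] would have to be at least r + 1. *)
  simpl in *; specialize (B (r + 1) ltac:(lra)); simpl in B; lra.
Qed.

Lemma entire_factorial_decay (c : nat -> C) (K : R) :
  (forall n, Cmod (c n) <= K ^ n / INR (fact n)) -> entire c.
Proof.
  intros H; split; apply CV_radius_factorial_decay with K; intros n;
    eapply Rle_trans; try apply (H n);
    (eapply Rle_trans; [|apply Rmax_Cmod]); [apply Rmax_l | apply Rmax_r].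
Qed.

(** * The Kummer series on the imaginary axis *)

(* Coefficients of [s |-> M(a, b, i s)]. *)
Definition kummer_coef (a b : C) (n : nat) : C :=
  (Cpoch a n / Cpoch b n * (Ci ^ n / RtoC (INR (fact n))))%C.

Lemma INR_fact_neq_0C (n : nat) : RtoC (INR (fact n)) <> RtoC 0.
Proof. intros E; apply RtoC_inj in E; now apply INR_fact_neq_0 in E. Qed.

(** Since (i s)^n = i^n s^n, the power of i moves into the coefficient and leaves a real
    variable. *)
Lemma Kummer_CPSeries (a b : C) (s : R) :
  Kummer a b (Ci * RtoC s) = CPSeries (kummer_coef a b) s.
Proof.
  unfold Kummer, CSeries, CPSeries, PSeries.
  assert (E : forall n, (Cpoch a n / Cpoch b n *
      ((Ci * RtoC s) ^ n / RtoC (INR (fact n))) =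
      kummer_coef a b n * RtoC (s ^ n))%C).
  { intros n; unfold kummer_coef; rewrite Cpow_mult_l, RtoC_pow; unfold Cdiv; ring. }
  f_equal; apply Series_ext; intros n; rewrite E; unfold Re, Im; simpl; ring.
Qed.

Lemma Cplus_pos_neq_0 (b : R) (n : nat) :
  0 < b -> (RtoC b + RtoC (INR n) <> RtoC 0)%C.
Proof.
  intros Hb E; rewrite <- RtoC_plus in E; apply RtoC_inj in E.
  pose proof (pos_INR n); lra.
Qed.

Lemma Cpoch_pos_neq_0 (b : R) (n : nat) : 0 < b -> Cpoch (RtoC b) n <> RtoC 0.
Proof.
  intros Hb; induction n as [|n IH]; simpl.
  - intros E; apply RtoC_inj in E; lra.
  - apply Cmult_neq_0; [exact IH | now apply Cplus_pos_neq_0].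
Qed.

(** The ratio of consecutive coefficients, cleared of denominators. It yields both the decay of the
    coefficients and the Kummer equation. *)
Lemma kummer_coef_succ (a : C) (b : R) (n : nat) :
  0 < b ->
  (RtoC (INR (S n)) * (RtoC b + RtoC (INR n)) * kummer_coef a (RtoC b) (S n)
   = Ci * (a + RtoC (INR n)) * kummer_coef a (RtoC b) n)%C.
Proof.
  intros Hb; unfold kummer_coef.
  rewrite fact_simpl, mult_INR, RtoC_mult, Cpow_S; simpl Cpoch.
  pose proof (Cpoch_pos_neq_0 b n Hb); pose proof (Cplus_pos_neq_0 b n Hb).
  pose proof (INR_fact_neq_0C n).
  assert (RtoC (INR (S n)) <> RtoC 0).
  { intros E; apply RtoC_inj in E; revert E; apply not_0_INR; discriminate. }
  field; auto.
Qed.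

(** By the recurrence, |c_(n+1)| = |a + n| |c_n| / ((n+1)(b+n)). The choice K = 1 + |a|/b ensures |a
    + n| <= |a| + n <= K (b + n), so |c_n| <= K^n / n! by induction. *)
Lemma kummer_coef_entire (a : C) (b : R) :
  0 < b -> entire (kummer_coef a (RtoC b)).
Proof.
  intros Hb.
  set (K := 1 + Cmod a / b).
  assert (HK : forall n, Cmod (a + RtoC (INR n)) <= K * (b + INR n)).
  { intros n; eapply Rle_trans; [apply Cmod_triangle|].
    rewrite Cmod_R, Rabs_pos_eq by apply pos_INR.
    pose proof (pos_INR n); pose proof (Cmod_ge_0 a).
    assert (0 <= Cmod a / b) by (apply Rdiv_le_0_compat; lra).
    assert (E : K * (b + INR n) = b + INR n + Cmod a + Cmod a / b * INR n)
      by (unfold K; field; lra).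
    rewrite E; nra. }
  apply entire_factorial_decay with K.
  induction n as [|n IH].
  - unfold kummer_coef; simpl.
    replace (_ * _)%C with (RtoC 1) by field.
    rewrite Cmod_1; lra.
  - pose proof (kummer_coef_succ a b n Hb) as E.
    apply (f_equal Cmod) in E; rewrite !Cmod_mult in E.
    rewrite <- RtoC_plus, !Cmod_R in E.
    pose proof (pos_INR n); pose proof (lt_0_INR (S n) ltac:(apply Nat.lt_0_succ)).
    rewrite !Rabs_pos_eq in E by lra.
    assert (Ci1 : Cmod Ci = 1).
    { unfold Cmod; simpl; replace (_ + _) with 1 by ring; apply sqrt_1. }
    rewrite Ci1 in E.
    pose proof (Cmod_ge_0 (kummer_coef a b n)).
    pose proof (Cmod_ge_0 (kummer_coef a b (S n))).
    rewrite fact_simpl, mult_INR; simpl pow.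
    apply Rmult_le_reg_l with (INR (S n) * (b + INR n)); [nra|].
    rewrite E.
    replace (INR (S n) * (b + INR n) * (K * K ^ n / (INR (S n) * INR (fact n))))
      with (K * (b + INR n) * (K ^ n / INR (fact n)))
      by (field; split; [apply INR_fact_neq_0 | lra]).
    rewrite Rmult_1_l.
    apply Rmult_le_compat; auto; apply Cmod_ge_0.
Qed.

(** One real component of the Kummer equation: multiplication by i couples the component [p] to the
    other one [q], with sign [e], and a = u + i v. The coefficient of s^n on the left is exactly the
    recurrence. *)
Lemma kummer_ode_real (p q : nat -> R) (b u v e s : R) :
  CV_radius p = p_infty -> CV_radius q = p_infty ->
  (forall n, INR (S n) * (b + INR n) * p (S n) + e * (INR n + u) * q n + v * p n = 0) ->
  s * PSeries (PS_derive (PS_derive p)) s + b * PSeries (PS_derive p) s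
  + e * (s * PSeries (PS_derive q) s + u * PSeries q s) + v * PSeries p s = 0.
Proof.
  intros Hp Hq Hrec.
  assert (X : forall a, CV_radius a = p_infty -> ex_pseries a s)
    by (intros a Ha; apply CV_radius_inside, entire_inside, Ha).
  assert (P1 : CV_radius (PS_derive p) = p_infty) by now rewrite CV_radius_derive.
  assert (P2 : CV_radius (PS_derive (PS_derive p)) = p_infty)
    by now rewrite CV_radius_derive.
  assert (Q1 : CV_radius (PS_derive q) = p_infty) by now rewrite CV_radius_derive.
  assert (SC : forall (c : R) (a : nat -> R), ex_pseries a s -> ex_pseries (PS_scal c a) s).
  { intros c a Ha; apply (@ex_pseries_scal R_AbsRing R_NormedModule); [apply Rmult_comm|exact Ha]. }
  assert (IN : forall a : nat -> R, ex_pseries a s -> ex_pseries (PS_incr_1 a) s).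
  { intros a Ha; exact (@ex_pseries_incr_1 R_AbsRing R_NormedModule a s Ha). }
  assert (PL : forall a a' : nat -> R, ex_pseries a s -> ex_pseries a' s ->
      ex_pseries (PS_plus a a') s).
  { intros a a' Ha Ha'; exact (@ex_pseries_plus R_AbsRing R_NormedModule a a' s Ha Ha'). }
  pose proof (X _ Hp) as X0; pose proof (X _ P1) as X1; pose proof (X _ P2) as X2.
  pose proof (X _ Hq) as Y0; pose proof (X _ Q1) as Y1.
  rewrite <- !PSeries_incr_1, <- !PSeries_scal.
  rewrite <- (PSeries_plus _ _ s (IN _ X2) (SC b _ X1)).
  rewrite <- (PSeries_plus _ _ s (IN _ Y1) (SC u _ Y0)).
  rewrite <- PSeries_scal.
  rewrite <- (PSeries_plus _ _ s (PL _ _ (IN _ X2) (SC b _ X1))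
                (SC e _ (PL _ _ (IN _ Y1) (SC u _ Y0)))).
  rewrite <- (PSeries_plus _ _ s (PL _ _ (PL _ _ (IN _ X2) (SC b _ X1))
                (SC e _ (PL _ _ (IN _ Y1) (SC u _ Y0)))) (SC v _ X0)).
  transitivity (PSeries (fun _ => 0) s); [|apply PSeries_const_0].
  apply PSeries_ext; intros n.
  unfold PS_plus, PS_scal, PS_incr_1, PS_derive, plus, scal; simpl.
  unfold mult; simpl.
  (* The shifted series have constant coefficient [zero], so n = 0 is a case of its own. *)
  destruct n as [|n].
  - specialize (Hrec 0%nat); unfold zero; simpl in *; lra.
  - specialize (Hrec (S n)); rewrite !S_INR in *.
    replace (match n with 0%nat => _ | S _ => _ end) with (INR n + 1) in *
      by (destruct n; simpl; ring).
    rewrite <- Hrec; ring.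
Qed.

(** Kummer's equation z M'' + (b - z) M' = a M at z = i s, rewritten for derivatives in s. Its real
    and imaginary parts are two instances of [kummer_ode_real], with p and q exchanged and e = 1,
    -1. *)
Lemma kummer_ode (a : C) (b s : R) :
  0 < b ->
  let c := kummer_coef a (RtoC b) in
  (RtoC s * CPSeries (CPS_derive (CPS_derive c)) s
   + RtoC b * CPSeries (CPS_derive c) s
   = Ci * (RtoC s * CPSeries (CPS_derive c) s + a * CPSeries c s))%C.
Proof.
  intros Hb c.
  destruct (kummer_coef_entire a b Hb) as [Hp Hq]; fold c in Hp, Hq.
  set (p := fun n => Re (c n)) in *; set (q := fun n => Im (c n)) in *.
  pose proof (kummer_ode_real p q b (Re a) (Im a) 1 s Hp Hq) as O1.
  pose proof (kummer_ode_real q p b (Re a) (Im a) (-1) s Hq Hp) as O2.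
  assert (D : forall n, (RtoC (INR (S n)) * (RtoC b + RtoC (INR n)) * c (S n)
     = Ci * (a + RtoC (INR n)) * c n)%C) by (intros n; now apply kummer_coef_succ).
  assert (R2 : forall n, Re (CPS_derive (CPS_derive c) n) = PS_derive (PS_derive p) n).
  { intros n; rewrite Re_CPS_derive; unfold PS_derive at 1 2; now rewrite Re_CPS_derive. }
  assert (I2 : forall n, Im (CPS_derive (CPS_derive c) n) = PS_derive (PS_derive q) n).
  { intros n; rewrite Im_CPS_derive; unfold PS_derive at 1 2; now rewrite Im_CPS_derive. }
  assert (F0 : CPSeries c s = (PSeries p s, PSeries q s)) by reflexivity.
  assert (F1 : CPSeries (CPS_derive c) s =
    (PSeries (PS_derive p) s, PSeries (PS_derive q) s)).
  { unfold CPSeries; f_equal; apply PSeries_ext; [apply Re_CPS_derive|apply Im_CPS_derive]. }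
  assert (F2 : CPSeries (CPS_derive (CPS_derive c)) s =
    (PSeries (PS_derive (PS_derive p)) s, PSeries (PS_derive (PS_derive q)) s)).
  { unfold CPSeries; f_equal; apply PSeries_ext; assumption. }
  rewrite F0, F1, F2.
  assert (D1 : forall n, INR (S n) * (b + INR n) * p (S n) + 1 * (INR n + Re a) * q n + Im a * p n = 0).
  { intros n; specialize (D n); apply (f_equal Re) in D.
    unfold p, q, Re, Im in *; unfold Cmult, Cplus, RtoC, Ci in D; cbn [fst snd] in D; lra. }
  assert (D2 : forall n, INR (S n) * (b + INR n) * q (S n) + (-1) * (INR n + Re a) * p n + Im a * q n = 0).
  { intros n; specialize (D n); apply (f_equal Im) in D.
    unfold p, q, Re, Im in *; unfold Cmult, Cplus, RtoC, Ci in D; cbn [fst snd] in D; lra. }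
  specialize (O1 D1); specialize (O2 D2).
  clearbody p q; clear - O1 O2.
  apply C_ext; unfold Re, Im, Cmult, Cplus, RtoC, Ci in *; cbn [fst snd]; lra.
Qed.

(** * The function exp(-i B x^2 / 2) M(a, b, i B x^2) and its derivatives *)

Section KummerGaussian.
Variables (a : C) (b : R) (B : R).
Hypothesis Hb : 0 < b.

Let c := kummer_coef a (RtoC b).
Let E (x : R) : C := Cexp (- (Ci * RtoC B / RtoC 2) * RtoC (x ^ 2)).
Let F0 (x : R) : C := CPSeries c (B * x ^ 2).
Let F1 (x : R) : C := CPSeries (CPS_derive c) (B * x ^ 2).
Let F2 (x : R) : C := CPSeries (CPS_derive (CPS_derive c)) (B * x ^ 2).

Definition kummer_gaussian (x : R) : C :=
  (E x * Kummer a (RtoC b) (Ci * RtoC (B * x ^ 2)))%C.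

(** The product rule: E' = -i B x E, and the inner function B x^2 contributes the factor 2 B x. *)
Definition kummer_gaussian1 (x : R) : C :=
  (E x * (RtoC (B * x) * (RtoC 2 * F1 x - Ci * F0 x)))%C.

(* The Kummer equation has been used to eliminate [F2]. *)
Definition kummer_gaussian2 (x : R) : C :=
  (E x * (RtoC B * ((Ci * (RtoC 4 * a - RtoC 1) - RtoC (B * x ^ 2)) * F0 x
                     + RtoC (2 - 4 * b) * F1 x)))%C.

Let dE (x : R) : is_derive_RC E x (- (Ci * RtoC (B * x)) * E x)%C.
Proof.
  eapply is_derive_RC_eq.
  - apply is_derive_RC_Cexp, is_derive_RC_scal, is_derive_RtoC.
    instantiate (1 := 2 * x); auto_derive; [easy | ring].
  - change (Cexp _) with (E x); rewrite !RtoC_mult; field; intros H; apply RtoC_inj in H; lra.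
Qed.

Let dsq (x : R) : is_derive (fun y => B * y ^ 2) x (2 * B * x).
Proof. auto_derive; [easy | ring]. Qed.

Let dF0 (x : R) : is_derive_RC F0 x (RtoC (2 * B * x) * F1 x)%C.
Proof.
  apply (is_derive_RC_comp (CPSeries c) (fun y => B * y ^ 2)); [|apply dsq].
  apply is_derive_CPSeries, kummer_coef_entire, Hb.
Qed.

Let dF1 (x : R) : is_derive_RC F1 x (RtoC (2 * B * x) * F2 x)%C.
Proof.
  apply (is_derive_RC_comp (CPSeries (CPS_derive c)) (fun y => B * y ^ 2)); [|apply dsq].
  apply is_derive_CPSeries, entire_derive, kummer_coef_entire, Hb.
Qed.

Lemma is_derive_kummer_gaussian (x : R) :
  is_derive_RC kummer_gaussian x (kummer_gaussian1 x).
Proof.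
  apply is_derive_RC_ext with (fun y => E y * F0 y)%C.
  - intros y; unfold kummer_gaussian; now rewrite Kummer_CPSeries.
  - eapply is_derive_RC_eq; [apply is_derive_RC_mult; [apply dE|apply dF0]|].
    unfold kummer_gaussian1; rewrite !RtoC_mult; ring.
Qed.

Lemma is_derive_kummer_gaussian1 (x : R) :
  is_derive_RC kummer_gaussian1 x (kummer_gaussian2 x).
Proof.
  eapply is_derive_RC_eq.
  - apply is_derive_RC_mult; [apply dE|].
    apply is_derive_RC_mult with (lf := RtoC B).
    + apply is_derive_RtoC; auto_derive; [easy|ring].
    + apply (is_derive_RC_plus (fun y => RtoC 2 * F1 y)%C (fun y => - (Ci * F0 y))%C).
      * apply is_derive_RC_scal, dF1.
      * eapply is_derive_RC_ext with (fun y => (- Ci) * F0 y)%C; [intros; ring|].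
        apply is_derive_RC_scal, dF0.
  - pose proof (kummer_ode a b (B * x ^ 2) Hb) as O; cbv zeta in O.
    fold c in O; fold (F0 x) (F1 x) (F2 x) in O.
    unfold kummer_gaussian2.
    (* The product rule produces [F2] only with the factor B x^2, which is the factor it carries in
       the Kummer equation. It is thus eliminated without dividing by x. *)
    assert (O' : (RtoC (B * x ^ 2) * F2 x =
      Ci * (RtoC (B * x ^ 2) * F1 x + a * F0 x) - RtoC b * F1 x)%C)
      by (rewrite <- O; ring).
    rewrite !RtoC_mult, RtoC_pow in *.
    transitivity (E x * (RtoC B * (RtoC 4 * (RtoC B * RtoC x ^ 2 * F2 x)
       + RtoC 2 * F1 x - Ci * F0 x
       - RtoC 4 * Ci * (RtoC B * RtoC x ^ 2) * F1 x
       + (Ci * Ci) * (RtoC B * RtoC x ^ 2) * F0 x)))%C; [simpl; ring|].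
    rewrite O'.
    replace (Ci * Ci)%C with (- RtoC 1)%C by (apply C_ext; cbv; ring).
    rewrite RtoC_minus, RtoC_mult.
    ring.
Qed.

Lemma kummer_gaussian_even (x : R) : kummer_gaussian (- x) = kummer_gaussian x.
Proof.
  unfold kummer_gaussian, E; now replace ((- x) ^ 2) with (x ^ 2) by ring.
Qed.

Lemma kummer_gaussian1_odd (x : R) : kummer_gaussian1 (- x) = (- kummer_gaussian1 x)%C.
Proof.
  unfold kummer_gaussian1, E, F0, F1; replace ((- x) ^ 2) with (x ^ 2) by ring.
  rewrite !RtoC_mult, RtoC_opp; ring.
Qed.

Lemma kummer_gaussian_0 : kummer_gaussian 0 = RtoC 1.
Proof.
  unfold kummer_gaussian; rewrite Kummer_CPSeries.
  replace (B * 0 ^ 2) with 0 by ring.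
  unfold CPSeries; rewrite !PSeries_0.
  unfold E, Cexp; replace (0 ^ 2) with 0 by ring.
  replace (- (Ci * RtoC B / RtoC 2) * RtoC 0)%C with (RtoC 0) by ring.
  unfold c, kummer_coef; simpl Cpoch; simpl Cpow; simpl fact; simpl INR.
  replace (RtoC 1 / RtoC 1 * (RtoC 1 / RtoC 1))%C with (RtoC 1) by field.
  simpl; rewrite exp_0, cos_0, sin_0; apply C_ext; simpl; ring.
Qed.

Lemma kummer_gaussian1_0 : kummer_gaussian1 0 = RtoC 0.
Proof. unfold kummer_gaussian1; rewrite Rmult_0_r; ring. Qed.

End KummerGaussian.

(** * The even and odd solutions for the parabolic potential *)

(* [k^2 - 2 U], with the parabola continued beyond the barrier so that [psi_e]
   and [psi_o] solve the equation on the whole line. *)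
Definition wavenumber_sqr (alpha U0 k x : R) : R :=
  k ^ 2 - 2 * (U0 / alpha ^ 2 * (alpha ^ 2 - x ^ 2)).

Section BarrierSolutions.
Variables alpha U0 k : R.
Hypothesis halpha : 0 < alpha.
Hypothesis hU0 : 0 < U0.

Let b := beta alpha U0.

Lemma beta_pos : 0 < beta alpha U0.
Proof. apply Rdiv_lt_0_compat; [apply sqrt_lt_R0; lra | exact halpha]. Qed.

Lemma beta_neq_0C : RtoC (beta alpha U0) <> RtoC 0.
Proof. intros E; apply RtoC_inj in E; pose proof beta_pos; lra. Qed.

(** This is beta^2 = 2 U_0 / alpha^2. *)
Lemma wavenumber_sqr_beta (x : R) :
  wavenumber_sqr alpha U0 k x = k ^ 2 - beta alpha U0 ^ 2 * (alpha ^ 2 - x ^ 2).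
Proof.
  unfold wavenumber_sqr, beta.
  replace ((sqrt (2 * U0) / alpha) ^ 2) with (2 * U0 / alpha ^ 2); [field; lra|].
  unfold Rdiv; rewrite Rpow_mult_distr, pow2_sqrt by lra; field; lra.
Qed.

Let wavenumber_sqr_C (x : R) : RtoC (wavenumber_sqr alpha U0 k x) =
  (RtoC k ^ 2 - RtoC b ^ 2 * (RtoC alpha ^ 2 - RtoC x ^ 2))%C.
Proof.
  rewrite wavenumber_sqr_beta; fold b.
  rewrite RtoC_minus, RtoC_mult, RtoC_minus, !RtoC_pow; reflexivity.
Qed.

Let Ci2 : (Ci * Ci)%C = (- RtoC 1)%C.
Proof. apply C_ext; cbv; ring. Qed.

Definition a_e : C :=
  (RtoC (1 / 4) * (RtoC 1 + Ci * RtoC (k ^ 2) / RtoC b - Ci * RtoC (alpha ^ 2 * b)))%C.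
Definition a_o : C :=
  (RtoC (1 / 4) * (RtoC 3 + Ci * RtoC (k ^ 2) / RtoC b - Ci * RtoC (alpha ^ 2 * b)))%C.

Lemma psi_e_eq (x : R) : psi_e alpha U0 k x = kummer_gaussian a_e (1 / 2) b x.
Proof. reflexivity. Qed.

Lemma psi_o_eq (x : R) :
  psi_o alpha U0 k x = (RtoC (x * sqrt (2 * b)) * kummer_gaussian a_o (3 / 2) b x)%C.
Proof. unfold psi_o, kummer_gaussian; fold b; symmetry; apply Cmult_assoc. Qed.

Definition psi_e1 (x : R) : C := kummer_gaussian1 a_e (1 / 2) b x.

Definition psi_o1 (x : R) : C :=
  (RtoC (sqrt (2 * b)) * (kummer_gaussian a_o (3 / 2) b x
     + RtoC x * kummer_gaussian1 a_o (3 / 2) b x))%C.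

Lemma is_derive_psi_e (x : R) : is_derive_RC (psi_e alpha U0 k) x (psi_e1 x).
Proof. apply is_derive_kummer_gaussian; lra. Qed.

(** In [kummer_gaussian2] the [F1] term has coefficient 2 - 4b, which vanishes at b = 1/2. The
    parameter [a_e] is tuned so that i beta (4 a_e - 1) = -k^2 + alpha^2 beta^2; together with
    -beta^2 x^2 this is minus the squared wavenumber. *)
Lemma is_derive_psi_e1 (x : R) :
  is_derive_RC psi_e1 x (- RtoC (wavenumber_sqr alpha U0 k x) * psi_e alpha U0 k x)%C.
Proof.
  eapply is_derive_RC_eq; [apply is_derive_kummer_gaussian1; lra|].
  rewrite psi_e_eq, wavenumber_sqr_C; unfold kummer_gaussian, kummer_gaussian2.
  rewrite Kummer_CPSeries.
  replace (2 - 4 * (1 / 2)) with 0 by field.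
  assert (A : (RtoC b * (Ci * (RtoC 4 * a_e - RtoC 1)) =
     - RtoC k ^ 2 + RtoC alpha ^ 2 * RtoC b ^ 2)%C).
  { transitivity ((Ci * Ci) * (RtoC k ^ 2 - RtoC alpha ^ 2 * RtoC b ^ 2))%C.
    - unfold a_e; rewrite RtoC_div, RtoC_mult, !RtoC_pow by lra.
      field; now apply beta_neq_0C.
    - rewrite Ci2; ring. }
  set (S := CPSeries _ _); set (S1 := CPSeries (CPS_derive _) _).
  set (E := Cexp _).
  transitivity (E * ((RtoC b * (Ci * (RtoC 4 * a_e - RtoC 1))
     - RtoC b * RtoC (b * x ^ 2)) * S))%C; [ring|].
  rewrite A, RtoC_mult, RtoC_pow; ring.
Qed.

Lemma is_derive_psi_o (x : R) : is_derive_RC (psi_o alpha U0 k) x (psi_o1 x).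
Proof.
  eapply is_derive_RC_ext; [intros y; symmetry; apply psi_o_eq|].
  eapply is_derive_RC_eq.
  - apply is_derive_RC_mult; [|apply is_derive_kummer_gaussian; lra].
    apply is_derive_RtoC; instantiate (1 := sqrt (2 * b)); auto_derive; [easy | ring].
  - unfold psi_o1; cbv beta; rewrite RtoC_mult; ring.
Qed.

(** Here (x G)'' = 2 G' + x G''. The term 2 G' contributes 4 beta x [F1], cancelling the -4 beta x
    [F1] that b = 3/2 leaves in x G'', and it turns the factor 4a - 1 into 4a - 3, for which [a_o]
    is tuned. *)
Lemma is_derive_psi_o1 (x : R) :
  is_derive_RC psi_o1 x (- RtoC (wavenumber_sqr alpha U0 k x) * psi_o alpha U0 k x)%C.
Proof.
  eapply is_derive_RC_eq.
  - apply is_derive_RC_scal, is_derive_RC_plus;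
      [apply is_derive_kummer_gaussian; lra|].
    apply is_derive_RC_mult; [|apply is_derive_kummer_gaussian1; lra].
    apply is_derive_RtoC, (is_derive_id x).
  - rewrite psi_o_eq, wavenumber_sqr_C;
      unfold kummer_gaussian, kummer_gaussian1, kummer_gaussian2.
    rewrite Kummer_CPSeries.
    change (@one R_AbsRing) with 1.
    assert (A : (RtoC b * (Ci * (RtoC 4 * a_o - RtoC 3)) =
       - RtoC k ^ 2 + RtoC alpha ^ 2 * RtoC b ^ 2)%C).
    { transitivity ((Ci * Ci) * (RtoC k ^ 2 - RtoC alpha ^ 2 * RtoC b ^ 2))%C.
      - unfold a_o; rewrite RtoC_div, RtoC_mult, !RtoC_pow by lra.
        field; now apply beta_neq_0C.
      - rewrite Ci2; ring. }
    replace (2 - 4 * (3 / 2)) with (- (4)) by field.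
    set (S := CPSeries (kummer_coef _ _) _); set (S1 := CPSeries (CPS_derive _) _).
    set (E := Cexp _).
    transitivity (RtoC (sqrt (2 * b)) * (RtoC x * (E *
      ((RtoC b * (Ci * (RtoC 4 * a_o - RtoC 3)) - RtoC b * RtoC (b * x ^ 2)) * S))))%C.
    + rewrite !RtoC_mult, RtoC_opp, RtoC_pow; ring.
    + rewrite A, !RtoC_mult, RtoC_pow; ring.
Qed.

Lemma psi_e_even (x : R) : psi_e alpha U0 k (- x) = psi_e alpha U0 k x.
Proof. apply kummer_gaussian_even. Qed.

Lemma psi_e1_odd (x : R) : psi_e1 (- x) = (- psi_e1 x)%C.
Proof. apply kummer_gaussian1_odd. Qed.

Lemma psi_o_odd (x : R) : psi_o alpha U0 k (- x) = (- psi_o alpha U0 k x)%C.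
Proof. rewrite !psi_o_eq, kummer_gaussian_even, !RtoC_mult, RtoC_opp; ring. Qed.

Lemma psi_o1_even (x : R) : psi_o1 (- x) = psi_o1 x.
Proof.
  unfold psi_o1; rewrite kummer_gaussian_even, kummer_gaussian1_odd, RtoC_opp; ring.
Qed.

Lemma psi_e_0 : psi_e alpha U0 k 0 = RtoC 1.
Proof. apply kummer_gaussian_0. Qed.

Lemma psi_e1_0 : psi_e1 0 = RtoC 0.
Proof. apply kummer_gaussian1_0. Qed.

Lemma psi_o_0 : psi_o alpha U0 k 0 = RtoC 0.
Proof. rewrite psi_o_eq, Rmult_0_l; ring. Qed.

Lemma psi_o1_0 : psi_o1 0 = RtoC (sqrt (2 * beta alpha U0)).
Proof. unfold psi_o1; rewrite kummer_gaussian_0, kummer_gaussian1_0; fold b; ring. Qed.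

End BarrierSolutions.

(** * Uniqueness for w'' + g w = 0 by an energy estimate *)

(** Gronwall's argument: f(x) exp(-K x) has nonpositive derivative and starts at 0, so the mean
    value theorem gives f <= 0, against f >= 0. *)
Lemma energy_nonincreasing (f f' : R -> R) (K X : R) :
  (forall x, 0 <= x <= X -> is_derive f x (f' x)) ->
  (forall x, 0 <= x <= X -> f' x <= K * f x) ->
  (forall x, 0 <= f x) -> f 0 = 0 ->
  forall x, 0 <= x <= X -> f x = 0.
Proof.
  intros Hd Hle Hpos H0 x Hx.
  set (h := fun y => f y * exp (- K * y)).
  set (h' := fun y => (f' y - K * f y) * exp (- K * y)).
  assert (Dh : forall y, 0 <= y <= X -> is_derive h y (h' y)).
  { intros y Hy; specialize (Hd y Hy); unfold h, h'.
    assert (ex_derive f y) by (eexists; apply Hd).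
    assert (Df : Derive (fun z : R => f z) y = f' y) by exact (is_derive_unique f y _ Hd).
    auto_derive; [easy|]; rewrite Df; ring. }
  destruct (MVT_gen h 0 x h') as [d [Hdx E]].
  - rewrite Rmin_left, Rmax_right by lra; intros y Hy; apply Dh; lra.
  - rewrite Rmin_left, Rmax_right by lra; intros y Hy.
    apply derivable_continuous_pt; exists (h' y); apply is_derive_Reals, Dh; lra.
  - rewrite Rmin_left, Rmax_right in Hdx by lra.
    assert (h 0 = 0) by (unfold h; rewrite H0; ring).
    assert (h' d <= 0).
    { unfold h'; specialize (Hle d ltac:(lra)); pose proof (exp_pos (- K * d)); nra. }
    assert (h x <= 0) by nra.
    unfold h in *; pose proof (exp_pos (- K * x)); specialize (Hpos x); nra.
Qed.

(** With u = w and v = w', the left side is the derivative of the energy w^2 + w'^2 along w'' = -g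
    w. The bound combines |2uv| <= u^2 + v^2 and |1 - g| <= 1 + M. *)
Lemma energy_growth (u v g M : R) :
  - M <= g <= M -> 2 * u * v * (1 - g) <= (1 + M) * (u ^ 2 + v ^ 2).
Proof.
  intros Hg; pose proof (pow2_ge_0 (u - v)); pose proof (pow2_ge_0 (u + v)).
  assert (2 * u * v <= u ^ 2 + v ^ 2) by lra.
  assert (- (2 * u * v) <= u ^ 2 + v ^ 2) by lra.
  nra.
Qed.

Lemma linear_ode_zero_right (w w1 g : R -> R) (M X : R) :
  (forall x, 0 <= x <= X -> is_derive w x (w1 x)) ->
  (forall x, 0 <= x <= X -> is_derive w1 x (- g x * w x)) ->
  (forall x, 0 <= x <= X -> Rabs (g x) <= M) ->
  w 0 = 0 -> w1 0 = 0 ->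
  forall x, 0 <= x <= X -> w x = 0 /\ w1 x = 0.
Proof.
  intros H1 H2 Hg H0 H0' x Hx.
  assert (E : w x ^ 2 + w1 x ^ 2 = 0).
  { apply (energy_nonincreasing (fun y => w y ^ 2 + w1 y ^ 2)
      (fun y => 2 * w y * w1 y * (1 - g y)) (1 + M) X); [| | | |exact Hx].
    - intros y Hy; specialize (H1 y Hy); specialize (H2 y Hy).
      assert (ex_derive w y) by (eexists; apply H1).
      assert (ex_derive w1 y) by (eexists; apply H2).
      assert (D1 : Derive (fun z : R => w z) y = w1 y) by exact (is_derive_unique w y _ H1).
      assert (D2 : Derive (fun z : R => w1 z) y = - g y * w y)
        by exact (is_derive_unique w1 y _ H2).
      auto_derive; [easy|]; rewrite D1, D2; ring.
    - intros y Hy; specialize (Hg y Hy); apply Rabs_le_between in Hg.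
      now apply energy_growth.
    - intros y; apply Rplus_le_le_0_compat; apply pow2_ge_0.
    - rewrite H0, H0'; ring. }
  nra.
Qed.

Lemma linear_ode_zero (w w1 g : R -> R) (M X : R) :
  (forall x, Rabs x <= X -> is_derive w x (w1 x)) ->
  (forall x, Rabs x <= X -> is_derive w1 x (- g x * w x)) ->
  (forall x, Rabs x <= X -> Rabs (g x) <= M) ->
  w 0 = 0 -> w1 0 = 0 ->
  forall x, Rabs x <= X -> w x = 0 /\ w1 x = 0.
Proof.
  intros H1 H2 Hg H0 H0' x Hx.
  destruct (Rle_lt_dec 0 x) as [P|N].
  - apply (linear_ode_zero_right w w1 g M X); auto.
    + intros y Hy; apply H1; rewrite Rabs_pos_eq; lra.
    + intros y Hy; apply H2; rewrite Rabs_pos_eq; lra.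
    + intros y Hy; apply Hg; rewrite Rabs_pos_eq; lra.
    + rewrite Rabs_pos_eq in Hx; lra.
  - assert (A : forall y, 0 <= y <= X -> Rabs (- y) <= X).
    { intros y Hy; rewrite Rabs_Ropp, Rabs_pos_eq; lra. }
    assert (N1 : forall y : R, is_derive (fun z : R => - z) y (-1)).
    { intros y; auto_derive; [easy|ring]. }
    (* Negative x is reduced to the right half by reflection; w(-y) has derivative -w'(-y) and
       solves the equation with g(-y). *)
    destruct (linear_ode_zero_right (fun y => w (- y)) (fun y => - w1 (- y))
      (fun y => g (- y)) M X) with (x := - x) as [Z1 Z2].
    + intros y Hy.
      replace (- w1 (- y)) with (scal (-1) (w1 (- y))) by (cbv; ring).
      apply (is_derive_comp w (fun z : R => - z)); [apply H1, A, Hy|apply N1].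
    + intros y Hy.
      replace (- g (- y) * w (- y)) with (- (scal (-1) (- g (- y) * w (- y))))
        by (cbv; ring).
      apply (@is_derive_opp R_AbsRing R_NormedModule (fun z => w1 (- z))).
      apply (is_derive_comp w1 (fun z : R => - z)); [apply H2, A, Hy|apply N1].
    + intros y Hy; apply Hg, A, Hy.
    + rewrite Ropp_0; exact H0.
    + rewrite Ropp_0, H0'; ring.
    + rewrite Rabs_left in Hx; lra.
    + rewrite Ropp_involutive in Z1, Z2; split; lra.
Qed.

(** As g is real, Im w solves the same equation, here with zero initial data. *)
Lemma linear_ode_real (w w1 : R -> C) (g : R -> R) (M X : R) :
  (forall x, Rabs x <= X -> is_derive_RC w x (w1 x)) ->
  (forall x, Rabs x <= X -> is_derive_RC w1 x (- RtoC (g x) * w x)%C) ->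
  (forall x, Rabs x <= X -> Rabs (g x) <= M) ->
  Im (w 0) = 0 -> Im (w1 0) = 0 ->
  forall x, Rabs x <= X -> Im (w x) = 0 /\ Im (w1 x) = 0.
Proof.
  intros H1 H2 Hg H0 H0' x Hx.
  apply (linear_ode_zero (fun y => Im (w y)) (fun y => Im (w1 y)) g M X); auto.
  + intros y Hy; specialize (H1 y Hy); apply is_derive_RC_pair in H1; apply H1.
  + intros y Hy; specialize (H2 y Hy); apply is_derive_RC_pair in H2.
    replace (- g y * Im (w y)) with (Im (- RtoC (g y) * w y)%C)
      by (unfold Im, Cmult, Copp, RtoC; cbn [fst snd]; ring); apply H2.
Qed.

Lemma linear_ode_zero_C (w w1 : R -> C) (g : R -> R) (M X : R) :
  (forall x, Rabs x <= X -> is_derive_RC w x (w1 x)) ->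
  (forall x, Rabs x <= X -> is_derive_RC w1 x (- RtoC (g x) * w x)%C) ->
  (forall x, Rabs x <= X -> Rabs (g x) <= M) ->
  w 0 = RtoC 0 -> w1 0 = RtoC 0 ->
  forall x, Rabs x <= X -> w x = RtoC 0.
Proof.
  intros H1 H2 Hg H0 H0' x Hx; apply C_ext.
  - apply (linear_ode_zero (fun y => Re (w y)) (fun y => Re (w1 y)) g M X); auto.
    + intros y Hy; specialize (H1 y Hy); apply is_derive_RC_pair in H1; apply H1.
    + intros y Hy; specialize (H2 y Hy); apply is_derive_RC_pair in H2.
      replace (- g y * Re (w y)) with (Re (- RtoC (g y) * w y)%C)
        by (unfold Re, Cmult, Copp, RtoC; cbn [fst snd]; ring); apply H2.
    + now rewrite H0.
    + now rewrite H0'.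
  - apply (linear_ode_real w w1 g M X); auto; [now rewrite H0 | now rewrite H0'].
Qed.

(** * Realness of the solutions at the edge *)

(** Inside the barrier 0 <= U <= U_0. This is the bound M of the energy estimate. *)
Lemma wavenumber_sqr_bounded (alpha U0 k x : R) :
  0 < alpha -> 0 < U0 -> Rabs x <= alpha ->
  Rabs (wavenumber_sqr alpha U0 k x) <= k ^ 2 + 2 * U0.
Proof.
  intros ha hU Hx; unfold wavenumber_sqr.
  assert (P : 0 <= x ^ 2 <= alpha ^ 2).
  { split; [apply pow2_ge_0|]; rewrite <- (pow2_abs x).
    apply pow_incr; split; [apply Rabs_pos|exact Hx]. }
  assert (Q : 0 <= U0 / alpha ^ 2 * (alpha ^ 2 - x ^ 2) <= U0).
  { assert (a2 : 0 < alpha ^ 2) by nra.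
    assert (0 < U0 / alpha ^ 2) by (apply Rdiv_lt_0_compat; lra).
    split; [nra|].
    replace U0 with (U0 / alpha ^ 2 * alpha ^ 2) at 2 by (field; lra).
    nra. }
  apply Rabs_le_between; pose proof (pow2_ge_0 k); lra.
Qed.

Section Realness.
Variables alpha U0 k : R.
Hypothesis halpha : 0 < alpha.
Hypothesis hU0 : 0 < U0.

Lemma psi_e_real : Im (psi_e alpha U0 k alpha) = 0 /\ Im (psi_e1 alpha U0 k alpha) = 0.
Proof.
  apply (linear_ode_real _ _ (wavenumber_sqr alpha U0 k) (k ^ 2 + 2 * U0) alpha).
  - intros; apply is_derive_psi_e.
  - intros; now apply is_derive_psi_e1.
  - intros; now apply wavenumber_sqr_bounded.
  - now rewrite psi_e_0.
  - now rewrite psi_e1_0.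
  - rewrite Rabs_pos_eq; lra.
Qed.

Lemma psi_o_real : Im (psi_o alpha U0 k alpha) = 0 /\ Im (psi_o1 alpha U0 k alpha) = 0.
Proof.
  apply (linear_ode_real _ _ (wavenumber_sqr alpha U0 k) (k ^ 2 + 2 * U0) alpha).
  - intros; apply is_derive_psi_o.
  - intros; now apply is_derive_psi_o1.
  - intros; now apply wavenumber_sqr_bounded.
  - now rewrite psi_o_0.
  - now rewrite psi_o1_0.
  - rewrite Rabs_pos_eq; lra.
Qed.
End Realness.

(** * Continuous differentiability of a function glued from two branches *)

Lemma is_derive_RC_continuous (f : R -> C) (x : R) (l : C) :
  is_derive_RC f x l -> @continuous R_UniformSpace C_UniformSpace f x.
Proof.
  intros H; exact (@ex_derive_continuous R_AbsRing C_R_NormedModule f x (ex_intro _ l H)).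
Qed.

(** Uniqueness of limits along [F]. With [at_left] and [at_right] it reads off a value at the gluing
    point from one side only. *)
Lemma continuous_eq_limit (F : (R -> Prop) -> Prop) (FF : ProperFilter F)
  (f g : R -> C) (a : R) :
  filter_le F (locally a) ->
  @continuous R_UniformSpace C_UniformSpace f a ->
  @continuous R_UniformSpace C_UniformSpace g a ->
  F (fun y => f y = g y) -> f a = g a.
Proof.
  intros HF Hf Hg E.
  apply (@filterlim_locally_unique R R_AbsRing C_R_NormedModule F _ g).
  - apply filterlim_ext_loc with f; [exact E|].
    intros P HP; apply HF, Hf, HP.
  - intros P HP; apply HF, Hg, HP.
Qed.

Section Glue.
Variables (f g h g1 h1 g2 h2 : R -> C) (a : R).
Hypothesis fg : locally a (fun y => y <= a -> f y = g y).
Hypothesis fh : locally a (fun y => a < y -> f y = h y).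
Hypothesis Dg : forall x, is_derive_RC g x (g1 x).
Hypothesis Dh : forall x, is_derive_RC h x (h1 x).
Hypothesis Dg1 : is_derive_RC g1 a (g2 a).
Hypothesis Dh1 : is_derive_RC h1 a (h2 a).

Let fa : f a = g a.
Proof. apply (locally_singleton _ _ fg); apply Rle_refl. Qed.

Let derive_left : locally a (fun y => y < a -> is_derive_RC f y (g1 y)).
Proof.
  apply locally_locally in fg; revert fg; apply filter_imp; intros y Hy Hlt.
  apply (@is_derive_ext_loc R_AbsRing C_R_NormedModule g f y); [|apply Dg].
  assert (L : locally y (fun z => z < a)) by (apply open_lt; exact Hlt).
  generalize (filter_and _ _ Hy L); apply filter_imp.
  intros z [H1 H2]; symmetry; apply H1; apply Rlt_le, H2.
Qed.

Let derive_right : locally a (fun y => a < y -> is_derive_RC f y (h1 y)).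
Proof.
  apply locally_locally in fh; revert fh; apply filter_imp; intros y Hy Hlt.
  apply (@is_derive_ext_loc R_AbsRing C_R_NormedModule h f y); [|apply Dh].
  assert (L : locally y (fun z => a < z)) by (apply open_gt; exact Hlt).
  generalize (filter_and _ _ Hy L); apply filter_imp.
  intros z [H1 H2]; symmetry; apply H1, H2.
Qed.

(** If f is C^1 at a, one-sided limits of f and of its derivative identify the values and slopes of
    both branches. Conversely, equal values and slopes make both branches share one linear
    approximation at a, and the derivative of f is continuous there because [g1] and [h1] are. *)
Lemma C1_at_glue : C1_at f a <-> g a = h a /\ g1 a = h1 a.
Proof.
  assert (Fr : filter_le (at_right a) (locally a)) by apply filter_le_within.
  assert (Fl : filter_le (at_left a) (locally a)) by apply filter_le_within.
  split.
  - intros [Ex Cont]; split.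
    + rewrite <- fa.
      apply (continuous_eq_limit (at_right a) _ f h a Fr).
      * destruct (locally_singleton _ _ Ex) as [l Hl].
        exact (is_derive_RC_continuous f a l Hl).
      * exact (is_derive_RC_continuous _ _ _ (Dh a)).
      * exact fh.
    + transitivity (Derive_RC f a).
      * symmetry; apply (continuous_eq_limit (at_left a) _ (Derive_RC f) g1 a Fl Cont).
        -- exact (is_derive_RC_continuous _ _ _ Dg1).
        -- unfold at_left, within; generalize derive_left; apply filter_imp; intros y Hy Hlt.
           now apply Derive_RC_unique, Hy.
      * apply (continuous_eq_limit (at_right a) _ (Derive_RC f) h1 a Fr Cont).
        -- exact (is_derive_RC_continuous _ _ _ Dh1).
        -- unfold at_right, within; generalize derive_right; apply filter_imp; intros y Hy Hlt.
           now apply Derive_RC_unique, Hy.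
  - intros [E0 E1].
    assert (Da : is_derive_RC f a (g1 a)).
    { destruct (Dg a) as [Lin Hg]; destruct (Dh a) as [_ Hh].
      split; [exact Lin|].
      intros x Hx eps.
      (* The limit point [x] in the definition of the differential can only be [a]. *)
      pose proof (@is_filter_lim_locally_unique R_AbsRing (AbsRing_NormedModule R_AbsRing)
        a x Hx) as <-.
      specialize (Hg a (fun P H => H) eps); specialize (Hh a (fun P H => H) eps).
      (* After identifying value and slope, the remainder estimates of g and h are the estimate of f
         on either side of a. *)
      rewrite <- E0, <- E1 in Hh; rewrite fa.
      generalize (filter_and _ _ (filter_and _ _ fg fh) (filter_and _ _ Hg Hh)).
      apply filter_imp; intros y [[F1 F2] [G H]].
      destruct (Rle_lt_dec y a) as [Hle|Hlt];
        [rewrite (F1 Hle); exact G | rewrite (F2 Hlt); exact H]. }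
    split.
    + generalize (filter_and _ _ derive_left derive_right); apply filter_imp.
      intros y [H1 H2].
      destruct (Rtotal_order y a) as [Hlt|[->|Hgt]].
      * exact (ex_intro _ (g1 y) (H1 Hlt)).
      * exact (ex_intro _ (g1 a) Da).
      * exact (ex_intro _ (h1 y) (H2 Hgt)).
    + intros P HP; unfold filtermap.
      rewrite (Derive_RC_unique _ _ _ Da) in HP.
      assert (Pg := is_derive_RC_continuous _ _ _ Dg1 P HP).
      rewrite E1 in HP.
      assert (Ph := is_derive_RC_continuous _ _ _ Dh1 P HP).
      unfold filtermap in Pg, Ph.
      generalize (filter_and _ _ (filter_and _ _ derive_left derive_right)
        (filter_and _ _ Pg Ph)); apply filter_imp.
      intros y [[H1 H2] [Q1 Q2]].
      destruct (Rtotal_order y a) as [Hlt|[->|Hgt]].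
      * now rewrite (Derive_RC_unique _ _ _ (H1 Hlt)).
      * now rewrite (Derive_RC_unique _ _ _ Da).
      * now rewrite (Derive_RC_unique _ _ _ (H2 Hgt)).
Qed.
End Glue.

(** * Plane waves and the matching conditions at the edges *)

Lemma Cexp_plus (z w : C) : Cexp (z + w) = (Cexp z * Cexp w)%C.
Proof.
  destruct z as [a b], w as [c d]; unfold Cexp, Re, Im, Cplus, Cmult; cbn [fst snd].
  rewrite exp_plus, cos_plus, sin_plus; f_equal; ring.
Qed.

Lemma Cexp_0 : Cexp (RtoC 0) = RtoC 1.
Proof. unfold Cexp; simpl; rewrite exp_0, cos_0, sin_0; apply C_ext; simpl; ring. Qed.

Lemma Cexp_opp (z : C) : (Cexp z * Cexp (- z) = RtoC 1)%C.
Proof. rewrite <- Cexp_plus, Cplus_opp_r; apply Cexp_0. Qed.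

Lemma Cmod_Cexp_imaginary (s : R) : Cmod (Cexp (Ci * RtoC s)) = 1.
Proof.
  unfold Cmod, Cexp, Ci, Cmult, RtoC, Re, Im; cbn [fst snd].
  replace (0 * s - 1 * 0) with 0 by ring; replace (0 * 0 + 1 * s) with s by ring.
  rewrite exp_0; replace (_ + _) with (Rsqr (sin s) + Rsqr (cos s)) by (unfold Rsqr; ring).
  rewrite sin2_cos2; apply sqrt_1.
Qed.

Lemma is_derive_plane_wave (k x : R) :
  is_derive_RC (plane_wave k) x (Ci * RtoC k * plane_wave k x)%C.
Proof.
  eapply is_derive_RC_eq.
  - apply is_derive_RC_Cexp, is_derive_RC_scal, is_derive_RtoC.
    instantiate (1 := k); auto_derive; [easy | ring].
  - reflexivity.
Qed.

Lemma plane_wave_opp (k x : R) : plane_wave (- k) (- x) = plane_wave k x.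
Proof. unfold plane_wave; now replace (- k * - x) with (k * x) by ring. Qed.

(** Parity moves the data of [psi_e] and [psi_o] from -alpha to alpha, so both edges involve the
    same four numbers. *)
Lemma C1_at_left_edge (alpha U0 k : R) (r A B t : C) :
  0 < alpha -> 0 < U0 ->
  C1_at (scattering_wave alpha U0 k r A B t) (- alpha) <->
  (plane_wave k (- alpha) + r * plane_wave k alpha
     = A * psi_e alpha U0 k alpha - B * psi_o alpha U0 k alpha /\
   Ci * RtoC k * (plane_wave k (- alpha) - r * plane_wave k alpha)
     = - (A * psi_e1 alpha U0 k alpha) + B * psi_o1 alpha U0 k alpha)%C.
Proof.
  intros ha hU.
  rewrite (C1_at_glue _
    (fun x => plane_wave k x + r * plane_wave (- k) x)%C
    (fun x => A * psi_e alpha U0 k x + B * psi_o alpha U0 k x)%C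
    (fun x => Ci * RtoC k * plane_wave k x + r * (Ci * RtoC (- k) * plane_wave (- k) x))%C
    (fun x => A * psi_e1 alpha U0 k x + B * psi_o1 alpha U0 k x)%C
    (fun x => Ci * RtoC k * (Ci * RtoC k * plane_wave k x)
      + r * (Ci * RtoC (- k) * (Ci * RtoC (- k) * plane_wave (- k) x)))%C
    (fun x => A * (- RtoC (wavenumber_sqr alpha U0 k x) * psi_e alpha U0 k x)
       + B * (- RtoC (wavenumber_sqr alpha U0 k x) * psi_o alpha U0 k x))%C (- alpha)).
  - rewrite plane_wave_opp, psi_e_even, psi_o_odd, psi_e1_odd, psi_o1_even, RtoC_opp.
    split; intros [H1 H2]; split.
    + rewrite H1; ring.
    + transitivity (Ci * k * plane_wave k (- alpha) + r * (Ci * - k * plane_wave k alpha))%C;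
        [ring|rewrite H2; ring].
    + rewrite H1; ring.
    + transitivity (Ci * k * (plane_wave k (- alpha) - r * plane_wave k alpha))%C;
        [ring|rewrite H2; ring].
  - apply filter_forall; intros y Hy; unfold scattering_wave.
    destruct (Rle_dec y (- alpha)); [reflexivity|contradiction].
  - assert (L : locally (- alpha) (fun y => y < alpha)) by (apply open_lt; lra).
    revert L; apply filter_imp; intros y Hy Hy'; unfold scattering_wave.
    destruct (Rle_dec y (- alpha)); [lra|].
    destruct (Rle_dec y alpha); [reflexivity|lra].
  - intros x; apply is_derive_RC_plus; [|apply is_derive_RC_scal];
      apply is_derive_plane_wave.
  - intros x; apply is_derive_RC_plus; apply is_derive_RC_scal;
      [apply is_derive_psi_e | apply is_derive_psi_o].
  - apply is_derive_RC_plus; [|apply is_derive_RC_scal];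
      apply is_derive_RC_scal, is_derive_plane_wave.
  - apply is_derive_RC_plus; apply is_derive_RC_scal;
      [now apply is_derive_psi_e1 | now apply is_derive_psi_o1].
Qed.

Lemma C1_at_right_edge (alpha U0 k : R) (r A B t : C) :
  0 < alpha -> 0 < U0 ->
  C1_at (scattering_wave alpha U0 k r A B t) alpha <->
  (A * psi_e alpha U0 k alpha + B * psi_o alpha U0 k alpha = t * plane_wave k alpha /\
   A * psi_e1 alpha U0 k alpha + B * psi_o1 alpha U0 k alpha
     = t * (Ci * RtoC k * plane_wave k alpha))%C.
Proof.
  intros ha hU.
  apply (C1_at_glue _
    (fun x => A * psi_e alpha U0 k x + B * psi_o alpha U0 k x)%C
    (fun x => t * plane_wave k x)%C
    (fun x => A * psi_e1 alpha U0 k x + B * psi_o1 alpha U0 k x)%C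
    (fun x => t * (Ci * RtoC k * plane_wave k x))%C
    (fun x => A * (- RtoC (wavenumber_sqr alpha U0 k x) * psi_e alpha U0 k x)
       + B * (- RtoC (wavenumber_sqr alpha U0 k x) * psi_o alpha U0 k x))%C
    (fun x => t * (Ci * RtoC k * (Ci * RtoC k * plane_wave k x)))%C).
  - assert (L : locally alpha (fun y => - alpha < y)) by (apply open_gt; lra).
    revert L; apply filter_imp; intros y Hy Hy'; unfold scattering_wave.
    destruct (Rle_dec y (- alpha)); [lra|].
    destruct (Rle_dec y alpha); [reflexivity|lra].
  - apply filter_forall; intros y Hy; unfold scattering_wave.
    destruct (Rle_dec y (- alpha)); [lra|].
    destruct (Rle_dec y alpha); [lra|reflexivity].
  - intros x; apply is_derive_RC_plus; apply is_derive_RC_scal;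
      [apply is_derive_psi_e | apply is_derive_psi_o].
  - intros x; apply is_derive_RC_scal, is_derive_plane_wave.
  - apply is_derive_RC_plus; apply is_derive_RC_scal;
      [now apply is_derive_psi_e1 | now apply is_derive_psi_o1].
  - apply is_derive_RC_scal, is_derive_RC_scal, is_derive_plane_wave.
Qed.

(** * Linear algebra of the four matching equations *)

Section Matching.
(** P, P1 and Q, Q1 stand for value and derivative at alpha of the even and odd solutions, e and em
    for exp(i k alpha) and its inverse, a for alpha. Plain letters keep the equations within reach
    of [field]. *)
Variables (r t A B P Q P1 Q1 e em ik a le lo : C).
Hypothesis e_em : (e * em = RtoC 1)%C.
Hypothesis P_neq_0 : P <> RtoC 0.
Hypothesis Q_neq_0 : Q <> RtoC 0.
Hypothesis a_neq_0 : a <> RtoC 0.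
Hypothesis le_def : (le = a * (P1 / P))%C.
Hypothesis lo_def : (lo = a * (Q1 / Q))%C.
Hypothesis le_neq : (le - ik * a)%C <> RtoC 0.
Hypothesis lo_neq : (lo - ik * a)%C <> RtoC 0.

Let two_neq_0 : RtoC 2 <> RtoC 0.
Proof. intros H; apply RtoC_inj in H; lra. Qed.

Let P1_eq : (P1 = le * P / a)%C.
Proof. rewrite le_def; field; auto. Qed.

Let Q1_eq : (Q1 = lo * Q / a)%C.
Proof. rewrite lo_def; field; auto. Qed.

Let e_neq_0 : e <> RtoC 0.
Proof.
  intros H; rewrite H, Cmult_0_l in e_em; apply RtoC_inj in e_em; lra.
Qed.

Let em_eq : em = (/ e)%C.
Proof.
  transitivity (e * em / e)%C; [field; exact e_neq_0 | rewrite e_em; field; exact e_neq_0].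
Qed.

(* Adding and subtracting the conditions at the two ends decouples them into
   one system for [(t + r, A)] and one for [(t - r, B)]. *)
Lemma matching_iff :
  ((em + r * e = A * P - B * Q /\ ik * (em - r * e) = - (A * P1) + B * Q1) /\
   (A * P + B * Q = t * e /\ A * P1 + B * Q1 = t * (ik * e)))%C <->
  (r = - RtoC (1 / 2) * (em * em) *
         ((le + ik * a) / (le - ik * a) + (lo + ik * a) / (lo - ik * a)) /\
   t = - RtoC (1 / 2) * (em * em) *
         ((le + ik * a) / (le - ik * a) - (lo + ik * a) / (lo - ik * a)) /\
   A = ((t + r) * e + em) / (RtoC 2 * P) /\
   B = ((t - r) * e - em) / (RtoC 2 * Q))%C.
Proof.
  rewrite RtoC_div by lra.
  split.
  - intros [[H1 H2] [H3 H4]].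
    assert (EA : (RtoC 2 * (A * P) = (t + r) * e + em)%C).
    { transitivity ((A * P - B * Q) + (A * P + B * Q))%C; [ring|].
      rewrite <- H1, H3; ring. }
    assert (EB : (RtoC 2 * (B * Q) = (t - r) * e - em)%C).
    { transitivity ((A * P + B * Q) - (A * P - B * Q))%C; [ring|].
      rewrite <- H1, H3; ring. }
    (* The difference of the derivative equations, times a, is 2 a A P1 = 2 le A P; inserting [EA]
       eliminates A. *)
    assert (S : ((t + r) * e * (le - ik * a) = - em * (le + ik * a))%C).
    { assert (X : (le * (RtoC 2 * (A * P)) = ik * a * ((t + r) * e - em))%C).
      { transitivity (a * ((A * P1 + B * Q1) - (- (A * P1) + B * Q1)))%C.
        - rewrite P1_eq; field; exact a_neq_0.
        - rewrite <- H2, H4; ring. }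
      rewrite EA in X.
      transitivity (le * ((t + r) * e + em) - ik * a * ((t + r) * e) - le * em)%C; [ring|].
      rewrite X; ring. }
    (* Likewise the sum of the derivative equations and [EB] eliminate B. *)
    assert (D : ((t - r) * e * (lo - ik * a) = em * (lo + ik * a))%C).
    { assert (X : (lo * (RtoC 2 * (B * Q)) = ik * a * ((t - r) * e + em))%C).
      { transitivity (a * ((A * P1 + B * Q1) + (- (A * P1) + B * Q1)))%C.
        - rewrite Q1_eq; field; exact a_neq_0.
        - rewrite <- H2, H4; ring. }
      rewrite EB in X.
      transitivity (lo * ((t - r) * e - em) - ik * a * ((t - r) * e) + lo * em)%C; [ring|].
      rewrite X; ring. }
    assert (S' : (t + r = - em * (le + ik * a) / (e * (le - ik * a)))%C)
      by (rewrite <- S; field; auto).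
    assert (D' : (t - r = em * (lo + ik * a) / (e * (lo - ik * a)))%C)
      by (rewrite <- D; field; auto).
    repeat split.
    + transitivity (((t + r) - (t - r)) / RtoC 2)%C; [field|].
      rewrite S', D', em_eq; field; auto.
    + transitivity (((t + r) + (t - r)) / RtoC 2)%C; [field|].
      rewrite S', D', em_eq; field; auto.
    + rewrite <- EA; field; auto.
    + rewrite <- EB; field; auto.
  - intros [Hr [Ht [HA HB]]].
    rewrite HA, HB, P1_eq, Q1_eq, Hr, Ht, em_eq.
    repeat split; field; repeat split; assumption.
Qed.
End Matching.

(** * Moduli of the reflection and transmission amplitudes *)

Lemma real_minus_imaginary_neq_0 (l q : R) : q <> 0 -> (RtoC l - Ci * RtoC q)%C <> RtoC 0.
Proof.
  intros Hq H; apply (f_equal Im) in H; revert H.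
  unfold Im, Cminus, Cplus, Copp, Cmult, Ci, RtoC; cbn [fst snd]; lra.
Qed.

Lemma Cmod_sqr_real_minus_imaginary (l q : R) :
  Cmod (RtoC l - Ci * RtoC q) ^ 2 = l ^ 2 + q ^ 2.
Proof.
  unfold Cmod; rewrite pow2_sqrt.
  - unfold Cminus, Cplus, Copp, Cmult, Ci, RtoC; cbn [fst snd]; ring.
  - apply Rplus_le_le_0_compat; apply pow2_ge_0.
Qed.

(** Over the common denominator (l - iq)(m - iq), the sum of the two fractions has numerator 2 (lm +
    q^2) and the difference -2 i q (l - m). The factors u and i have modulus one, and |l - iq|^2 =
    l^2 + q^2. *)
Lemma scattering_coefficients (l m q : R) (u : C) :
  q <> 0 -> Cmod u = 1 ->
  let r := (- RtoC (1 / 2) * u * ((RtoC l + Ci * RtoC q) / (RtoC l - Ci * RtoC q)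
              + (RtoC m + Ci * RtoC q) / (RtoC m - Ci * RtoC q)))%C in
  let t := (- RtoC (1 / 2) * u * ((RtoC l + Ci * RtoC q) / (RtoC l - Ci * RtoC q)
              - (RtoC m + Ci * RtoC q) / (RtoC m - Ci * RtoC q)))%C in
  let D := (l ^ 2 + q ^ 2) * (m ^ 2 + q ^ 2) in
  Cmod r ^ 2 = (l * m + q ^ 2) ^ 2 / D /\ Cmod t ^ 2 = q ^ 2 * (l - m) ^ 2 / D.
Proof.
  intros Hq Hu r t D.
  pose proof (real_minus_imaginary_neq_0 l q Hq) as Hl.
  pose proof (real_minus_imaginary_neq_0 m q Hq) as Hm.
  assert (Ci2 : (Ci * Ci)%C = (- RtoC 1)%C) by (apply C_ext; cbv; ring).
  assert (Ci1 : Cmod Ci = 1).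
  { unfold Cmod; simpl; replace (_ + _) with 1 by ring; apply sqrt_1. }
  set (zl := (RtoC l - Ci * RtoC q)%C) in *; set (zm := (RtoC m - Ci * RtoC q)%C) in *.
  assert (Er : (r = - u * (RtoC (l * m + q ^ 2) / (zl * zm)))%C).
  { unfold r; rewrite RtoC_plus, RtoC_mult, RtoC_pow, RtoC_div by lra.
    transitivity (- u * ((RtoC l * RtoC m - Ci * Ci * RtoC q ^ 2) / (zl * zm)))%C.
    - unfold zl, zm in *; field; auto.
    - rewrite Ci2; field; auto. }
  assert (Et : (t = u * (Ci * RtoC (q * (l - m)) / (zl * zm)))%C).
  { unfold t; rewrite RtoC_mult, RtoC_minus, RtoC_div by lra.
    unfold zl, zm in *; field; auto. }
  assert (Nl : Cmod zl <> 0) by (intros H; now apply Cmod_eq_0 in H).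
  assert (Nm : Cmod zm <> 0) by (intros H; now apply Cmod_eq_0 in H).
  assert (Dz : D = Cmod zl ^ 2 * Cmod zm ^ 2).
  { unfold zl, zm; now rewrite !Cmod_sqr_real_minus_imaginary. }
  assert (Nz : (zl * zm)%C <> RtoC 0) by now apply Cmult_neq_0.
  rewrite Er, Et, Dz.
  rewrite !Cmod_mult, Cmod_opp, !Cmod_div, !Cmod_mult, !Cmod_R, Hu, Ci1 by assumption.
  split.
  - rewrite <- (pow2_abs (l * m + q ^ 2)); field; auto.
  - replace (q ^ 2 * (l - m) ^ 2) with ((q * (l - m)) ^ 2) by ring.
    rewrite <- (pow2_abs (q * (l - m))); field; auto.
Qed.

Lemma real_quotient (a : R) (z w : C) :
  Im z = 0 -> Im w = 0 -> exists l : R, (RtoC a * (w / z))%C = RtoC l.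
Proof.
  destruct z as [z z'], w as [w w']; simpl; intros -> ->.
  (* The witness copies the formula of [Cinv] at a real argument, so [ring] closes the identity,
     including the default value at z = 0. *)
  exists (a * (w * (z / (z ^ 2 + 0 ^ 2)))).
  unfold Cdiv, Cinv, Cmult, RtoC; cbn [fst snd]; unfold Rdiv; f_equal; ring.
Qed.

Lemma L_e_real (alpha U0 k : R) :
  0 < alpha -> 0 < U0 -> exists l : R, L_e alpha U0 k = RtoC l.
Proof.
  intros ha hU; unfold L_e.
  rewrite (Derive_RC_unique _ _ _ (is_derive_psi_e alpha U0 k alpha)).
  apply real_quotient; now apply psi_e_real.
Qed.

Lemma L_o_real (alpha U0 k : R) :
  0 < alpha -> 0 < U0 -> exists l : R, L_o alpha U0 k = RtoC l.
Proof.
  intros ha hU; unfold L_o.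
  rewrite (Derive_RC_unique _ _ _ (is_derive_psi_o alpha U0 k alpha)).
  apply real_quotient; now apply psi_o_real.
Qed.

(** * General solution inside the barrier and conclusion *)

Lemma schrodinger_solution_inside (alpha U0 k : R) (psi : R -> C) :
  0 < alpha -> 0 < U0 -> schrodinger_solution alpha U0 k psi ->
  exists A B : C, forall x : R, Rabs x <= alpha ->
    psi x = (A * psi_e alpha U0 k x + B * psi_o alpha U0 k x)%C.
Proof.
  intros ha hU [p1 [p2 H]].
  assert (Hs : RtoC (sqrt (2 * beta alpha U0)) <> RtoC 0).
  { intros E; apply RtoC_inj in E.
    pose proof (beta_pos alpha U0 ha hU).
    pose proof (sqrt_lt_R0 (2 * beta alpha U0) ltac:(lra)); lra. }
  (* These coefficients match value and derivative at 0, where [psi_e] has data (1, 0) and [psi_o]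
     has (0, sqrt(2 beta)). The difference [w] then has zero data. *)
  set (A := psi 0); set (B := (p1 0 / RtoC (sqrt (2 * beta alpha U0)))%C).
  exists A, B; intros x Hx.
  set (w := fun y => (psi y + - RtoC 1 * (A * psi_e alpha U0 k y + B * psi_o alpha U0 k y))%C).
  set (w1 := fun y => (p1 y + - RtoC 1 * (A * psi_e1 alpha U0 k y + B * psi_o1 alpha U0 k y))%C).
  assert (W : w x = RtoC 0).
  { apply (linear_ode_zero_C w w1 (wavenumber_sqr alpha U0 k) (k ^ 2 + 2 * U0) alpha); [| | | | |exact Hx].
    - intros y _; apply is_derive_RC_plus; [apply H|].
      apply is_derive_RC_scal, is_derive_RC_plus; apply is_derive_RC_scal;
        [apply is_derive_psi_e | apply is_derive_psi_o].
    - intros y Hy; destruct (H y) as [_ [D2 Eq]].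
      assert (Ey : p2 y = (- RtoC (wavenumber_sqr alpha U0 k y) * psi y)%C).
      (* For |y| <= alpha the barrier is the parabola. *)
      { replace (k ^ 2 - 2 * barrier alpha U0 y) with (wavenumber_sqr alpha U0 k y) in Eq.
        - transitivity (p2 y + RtoC (wavenumber_sqr alpha U0 k y) * psi y
            - RtoC (wavenumber_sqr alpha U0 k y) * psi y)%C; [ring|rewrite Eq; ring].
        - unfold wavenumber_sqr, barrier; destruct (Rle_dec (Rabs y) alpha); [reflexivity|contradiction]. }
      eapply is_derive_RC_eq.
      + apply is_derive_RC_plus; [exact D2|].
        apply is_derive_RC_scal, is_derive_RC_plus; apply is_derive_RC_scal;
          [now apply is_derive_psi_e1 | now apply is_derive_psi_o1].
      + rewrite Ey; unfold w; ring.
    - intros y Hy; now apply wavenumber_sqr_bounded.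
    - unfold w; rewrite psi_e_0, psi_o_0; unfold A; ring.
    - unfold w1; rewrite psi_e1_0, psi_o1_0; unfold B; field; exact Hs. }
  transitivity (w x + (A * psi_e alpha U0 k x + B * psi_o alpha U0 k x))%C;
    [unfold w; ring | rewrite W; ring].
Qed.

Theorem mainTheorem2 (alpha U0 k : R)
  (halpha : 0 < alpha) (hU0 : 0 < U0) (hk : 0 < k) :
  let Le := L_e alpha U0 k in
  let Lo := L_o alpha U0 k in
  let ika := (Ci * RtoC (k * alpha))%C in
  let e_ika := Cexp ika in
  let e_mika := Cexp (- ika)%C in
  let e_m2ika := Cexp (- (RtoC 2 * ika))%C in
  (forall (psi : R -> C) (r t : C),
      schrodinger_solution alpha U0 k psi ->
      (forall x : R, x <= - alpha ->
         psi x = (plane_wave k x + r * plane_wave (- k) x)%C) ->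
      (forall x : R, alpha <= x -> psi x = (t * plane_wave k x)%C) ->
      exists A B : C, forall x : R, psi x = scattering_wave alpha U0 k r A B t x)
  /\
  (psi_e alpha U0 k alpha <> RtoC 0 ->
   psi_o alpha U0 k alpha <> RtoC 0 ->
  (forall r A B t : C,
      (C1_at (scattering_wave alpha U0 k r A B t) (- alpha) /\
       C1_at (scattering_wave alpha U0 k r A B t) alpha)
      <->
      (r = (- RtoC (1 / 2) * e_m2ika *
              ((Le + ika) / (Le - ika) + (Lo + ika) / (Lo - ika)))%C /\
       t = (- RtoC (1 / 2) * e_m2ika *
              ((Le + ika) / (Le - ika) - (Lo + ika) / (Lo - ika)))%C /\
       A = (((t + r) * e_ika + e_mika) / (RtoC 2 * psi_e alpha U0 k alpha))%C /\
       B = (((t - r) * e_ika - e_mika) / (RtoC 2 * psi_o alpha U0 k alpha))%C))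
  /\
  (forall r A B t : C,
      C1_at (scattering_wave alpha U0 k r A B t) (- alpha) ->
      C1_at (scattering_wave alpha U0 k r A B t) alpha ->
      let Rc := Cmod r ^ 2 in
      let Tc := Cmod t ^ 2 in
      let D := ((Le ^ 2 + RtoC (k ^ 2 * alpha ^ 2)) *
                (Lo ^ 2 + RtoC (k ^ 2 * alpha ^ 2)))%C in
      RtoC Rc = ((Le * Lo + RtoC (k ^ 2 * alpha ^ 2)) ^ 2 / D)%C /\
      RtoC Tc = (RtoC (k ^ 2 * alpha ^ 2) * (Le - Lo) ^ 2 / D)%C /\
      Rc + Tc = 1)).
Proof.
  intros Le Lo ika e_ika e_mika e_m2ika.
  split.
  { intros psi r t Hs Hl Hr.
    destruct (schrodinger_solution_inside alpha U0 k psi halpha hU0 Hs) as [A [B HAB]].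
    exists A, B; intros x; unfold scattering_wave.
    destruct (Rle_dec x (- alpha)); [now apply Hl|].
    destruct (Rle_dec x alpha); [|apply Hr; lra].
    apply HAB, Rabs_le; lra. }
  intros He Ho.
  assert (Hq : k * alpha <> 0) by nra.
  destruct (L_e_real alpha U0 k halpha hU0) as [l Hl]; fold Le in Hl.
  destruct (L_o_real alpha U0 k halpha hU0) as [m Hm]; fold Lo in Hm.
  assert (Nl : (Le - ika)%C <> RtoC 0).
  { rewrite Hl; now apply real_minus_imaginary_neq_0. }
  assert (Nm : (Lo - ika)%C <> RtoC 0).
  { rewrite Hm; now apply real_minus_imaginary_neq_0. }
  assert (E2 : e_m2ika = (e_mika * e_mika)%C).
  { unfold e_m2ika, e_mika; rewrite <- Cexp_plus; f_equal; ring. }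
  assert (Wp : plane_wave k alpha = e_ika) by reflexivity.
  assert (Wm : plane_wave k (- alpha) = e_mika).
  { unfold plane_wave, e_mika, ika; f_equal.
    replace (k * - alpha) with (- (k * alpha)) by ring; rewrite RtoC_opp; ring. }
  assert (ika_eq : ika = (Ci * RtoC k * RtoC alpha)%C)
    by (unfold ika; rewrite RtoC_mult; ring).
  assert (Main : forall r A B t : C,
      (C1_at (scattering_wave alpha U0 k r A B t) (- alpha) /\
       C1_at (scattering_wave alpha U0 k r A B t) alpha)
      <->
      (r = (- RtoC (1 / 2) * e_m2ika *
              ((Le + ika) / (Le - ika) + (Lo + ika) / (Lo - ika)))%C /\
       t = (- RtoC (1 / 2) * e_m2ika *
              ((Le + ika) / (Le - ika) - (Lo + ika) / (Lo - ika)))%C /\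
       A = (((t + r) * e_ika + e_mika) / (RtoC 2 * psi_e alpha U0 k alpha))%C /\
       B = (((t - r) * e_ika - e_mika) / (RtoC 2 * psi_o alpha U0 k alpha))%C)).
  { intros r A B t.
    rewrite C1_at_left_edge, C1_at_right_edge by assumption.
    rewrite Wp, Wm, E2, ika_eq; rewrite ika_eq in Nl, Nm.
    apply matching_iff with (P1 := psi_e1 alpha U0 k alpha) (Q1 := psi_o1 alpha U0 k alpha);
      try assumption.
    - apply Cexp_opp.
    - intros H; apply RtoC_inj in H; lra.
    - unfold Le, L_e; now rewrite (Derive_RC_unique _ _ _ (is_derive_psi_e alpha U0 k alpha)).
    - unfold Lo, L_o; now rewrite (Derive_RC_unique _ _ _ (is_derive_psi_o alpha U0 k alpha)). }
  split; [exact Main|].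
  intros r A B t C1 C2 Rc Tc D.
  destruct (proj1 (Main r A B t) (conj C1 C2)) as [Er [Et _]].
  (* The common phase exp(-2 i k alpha) does not affect the moduli. *)
  assert (Hu : Cmod e_m2ika = 1).
  { unfold e_m2ika; replace (- (RtoC 2 * ika))%C with (Ci * RtoC (- (2 * (k * alpha))))%C
      by (unfold ika; rewrite RtoC_opp, RtoC_mult; ring).
    apply Cmod_Cexp_imaginary. }
  rewrite Hl, Hm in Er, Et.
  destruct (scattering_coefficients l m (k * alpha) e_m2ika Hq Hu) as [ER ET].
  fold ika in ER, ET; rewrite <- Er in ER; rewrite <- Et in ET.
  fold Rc in ER; fold Tc in ET.
  assert (Dl : l ^ 2 + k ^ 2 * alpha ^ 2 <> 0) by nra.
  assert (Dm : m ^ 2 + k ^ 2 * alpha ^ 2 <> 0) by nra.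
  replace ((k * alpha) ^ 2) with (k ^ 2 * alpha ^ 2) in ER, ET by ring.
  (* Since [Le] and [Lo] are the reals l and m, the complex formulas descend to real ones. *)
  assert (HD : D = RtoC ((l ^ 2 + k ^ 2 * alpha ^ 2) * (m ^ 2 + k ^ 2 * alpha ^ 2))).
  { unfold D; rewrite Hl, Hm, <- !RtoC_pow, <- !RtoC_plus, <- RtoC_mult; reflexivity. }
  assert (Dn : (l ^ 2 + k ^ 2 * alpha ^ 2) * (m ^ 2 + k ^ 2 * alpha ^ 2) <> 0)
    by (apply Rmult_integral_contrapositive; split; assumption).
  assert (NR : ((RtoC l * RtoC m + RtoC (k ^ 2 * alpha ^ 2)) ^ 2)%C
    = RtoC ((l * m + k ^ 2 * alpha ^ 2) ^ 2))
    by now rewrite <- RtoC_mult, <- RtoC_plus, <- RtoC_pow.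
  assert (NT : (RtoC (k ^ 2 * alpha ^ 2) * (RtoC l - RtoC m) ^ 2)%C
    = RtoC (k ^ 2 * alpha ^ 2 * (l - m) ^ 2))
    by now rewrite <- RtoC_minus, <- RtoC_pow, <- RtoC_mult.
  rewrite HD, Hl, Hm, NR, NT, <- (RtoC_div _ _ Dn), <- (RtoC_div _ _ Dn), ER, ET.
  (* R + T = 1 is the identity (lm + q^2)^2 + q^2 (l - m)^2 = (l^2 + q^2)(m^2 + q^2) with q = k
     alpha. *)
  repeat split; field; rewrite Rpow_mult_distr; split; assumption.
Qed.
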